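(* Let $n$ be a positive integer, let $\lambda$ be a partition of the set $[n]=\{1,\ldots,n\}$ and let $\mathbb{C}^\lambda$ be the subspace of $\mathbb{C}^n$ consisting of all points $\mathbf{z} = (z_1,\ldots,z_n)$ such that, for all $i,j\in[n]$, $z_i = z_j$ if and only if $i$ and $j$ belong to the same block of $\lambda$. Let $\overline{\mathbb{C}^\lambda}$ be the closure of $\mathbb{C}^\lambda$ in $\mathbb{C}^n$, and let $\theta\colon\mathbb{C}^n\to\mathbb{C}^n$ be the map defined in the context. Then $\theta$ restricts to a map $\theta_\lambda \colon \mathbb{C}^\lambda \to \overline{\mathbb{C}^\lambda}$, and $\theta_\lambda$ is a local homeomorphism at $\mathbf{z} \in \mathbb{C}^\lambda$ if the entries of $\mathbf{z}$ are nonzero.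
   Context: For $\mathbf{z}=(z_1,\ldots,z_n)\in\mathbb{C}^n$ let $p_{\mathbf{z}}(z)=\int_0^z (w-z_1)\cdots(w-z_n)\,dw$. The map $\theta\colon\mathbb{C}^n\to\mathbb{C}^n$ is $\theta(\mathbf{z})=(p_{\mathbf{z}}(z_1),\ldots,p_{\mathbf{z}}(z_n))$. A partition of $[n]$ is a collection of nonempty pairwise disjoint subsets (blocks) whose union is $[n]$. The spaces $\mathbb{C}^\lambda$ and $\overline{\mathbb{C}^\lambda}$ carry the subspace topology from $\mathbb{C}^n$. *)

(* Defs.v *)
From HB Require Import structures.
From mathcomp Require Import all_boot all_order all_algebra.
From mathcomp Require Import complex.
From mathcomp Require Import all_classical all_reals all_analysis.
Import Order.TTheory GRing.Theory Num.Theory numFieldNormedType.Exports.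

Set Implicit Arguments.
Unset Strict Implicit.
Unset Printing Implicit Defensive.

Local Open Scope classical_set_scope.
Local Open Scope complex_scope.
Local Open Scope ring_scope.

(* R[i] with the topology of its norm, inherited from that of numeric fields. *)
HB.instance Definition _ (R : realType) := GRing.ComAlgebra.copy R[i] R[i]^o.
HB.instance Definition _ (R : realType) := Vector.copy R[i] R[i]^o.
HB.instance Definition _ (R : realType) := NormedModule.copy R[i] R[i]^o.

(* The integral of f from 0 to z along the segment t |-> t z, 0 <= t <= 1.  For
   the polynomial integrands below every path from 0 to z gives the same value. *)
Definition segment_integral (R : realType) (f : R[i] -> R[i]) (z : R[i]) : R[i] :=
  let g (t : R) := f (t%:C * z) * z in
  (\int[lebesgue_measure]_(t in `[0%R, 1%R]) complex.Re (g t)) +i*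
  (\int[lebesgue_measure]_(t in `[0%R, 1%R]) complex.Im (g t)).

Definition p_ (R : realType) (n : nat) (zs : 'rV[R[i]]_n) : R[i] -> R[i] :=
  segment_integral (fun w => \prod_(i < n) (w - zs ord0 i)).

Definition theta (R : realType) (n : nat) (zs : 'rV[R[i]]_n) : 'rV[R[i]]_n :=
  \row_(i < n) p_ zs (zs ord0 i).

Definition stratum (R : realType) (n : nat) (lambda : {set {set 'I_n}}) :
    set 'rV[R[i]]_n :=
  [set zs | forall i j : 'I_n,
     zs ord0 i = zs ord0 j <->
     exists2 B, B \in lambda & (i \in B) && (j \in B)].

Arguments stratum R {n} lambda.

Definition homeomorphism (X Y : topologicalType) (f : X -> Y) : Prop :=
  continuous f /\
  exists g : Y -> X, [/\ continuous g, cancel f g & cancel g f].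

(* A set coerces to the subtype of its elements, with the subspace topology. *)
Definition local_homeomorphism_at (X Y : topologicalType) (f : X -> Y) (x : X) :
    Prop :=
  exists U : set X, [/\ open U, U x, open (f @` U) &
    exists2 fU : U -> f @` U,
      (forall u : U, set_val (fU u) = f (set_val u)) & homeomorphism fU].

(* Main.v *)
Require Import Defs.
From HB Require Import structures.
From mathcomp Require Import all_boot all_order all_algebra ring.
From mathcomp Require Import complex.
From mathcomp Require Import all_classical all_reals all_analysis.
Import Order.TTheory GRing.Theory Num.Theory numFieldNormedType.Exports.
Local Open Scope classical_set_scope.
Local Open Scope complex_scope.
Local Open Scope ring_scope.

(** Write P_z for the product of the X - z_i and prim for the antiderivative of
    a polynomial that vanishes at 0, so that theta(z)_i = prim(P_z)(z_i)
    ([theta_primitive], by the fundamental theorem of calculus). If z_i = z_j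
    then theta(z)_i = theta(z)_j, and the closure of the stratum is exactly the
    linear subspace D of the points that are constant on the blocks
    ([closure_fibers_exactly]); hence theta maps the stratum into its closure.

    The stratum is open in D, so theta restricted to D has to be inverted near a
    point z with nonzero entries. Since P_z vanishes at every z_i, the
    derivative of theta at z in the direction h has coordinates q(z_i), where q
    = - prim(Q) and Q is the sum over j of h_j times the product of the X - z_l,
    l <> j. It is injective on D. Indeed, if m entries of z equal c then Q is
    divisible by (X - c)^(m-1); so if q vanishes at c, then c is a root of q of
    multiplicity at least m. If q vanishes at all z_i, then q has n roots with
    multiplicity among the z_i and the further root 0, although its degree is at
    most n. Hence Q = 0. Modulo (X - z_i)^m, where m is the multiplicity of z_i
    in z, Q is h_i times the derivative of P_z, and this derivative is not zero;
    so h_i = 0 ([weighted_deriv_inj]).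

    To avoid coordinates on D, theta is replaced by the map z |-> theta(pi z) +
    (z - pi z), where pi projects onto D by copying the entry at a chosen
    representative of each block. This map agrees with theta on D, maps a point
    into D only if the point is in D, and has an invertible derivative at z. The
    inverse function theorem ([inverse_function]) makes it injective, continuous
    and open near z, and these properties pass to the stratum and its closure
    ([local_homeomorphism_at_restriction]).

    The inverse function theorem is proved for maps on C^n that are strictly
    differentiable at one point. Strict differentiability is stable under sums
    and products, so that it holds for polynomial maps by algebra alone, and it
    says that, when the derivative is invertible, the map is locally the
    identity plus a contraction, up to a linear change of coordinates. Openness
    then follows from a fixed point iteration in the complete space C^n
    ([near_identity_solve]). *)

Set Implicit Arguments.
Unset Strict Implicit.

(** * Antiderivatives of polynomials and the integral defining theta *)

Section primitive.
Context {F : numFieldType}.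
Implicit Types p q : {poly F}.

Definition primitive p : {poly F} :=
  \poly_(j < (size p).+1) (if j is k.+1 then p`_k / k.+1%:R else 0).

Lemma coef_primitive0 p : (primitive p)`_0 = 0.
Proof. by rewrite coef_poly. Qed.

Lemma coef_primitiveS p k : (primitive p)`_k.+1 = p`_k / k.+1%:R.
Proof.
by rewrite coef_poly ltnS; case: ltnP => // /(nth_default 0) ->; rewrite mul0r.
Qed.

Lemma size_primitive p : (size (primitive p) <= (size p).+1)%N.
Proof. exact: size_poly. Qed.

Lemma horner_primitive n p x : (size p <= n)%N ->
  (primitive p).[x] = \sum_(j < n) p`_j / j.+1%:R * x ^+ j.+1.
Proof.
move=> pn; rewrite (@horner_coef_wide _ n.+1); last first.
  by rewrite (leq_trans (size_primitive p)).
rewrite big_ord_recl coef_primitive0 mul0r add0r.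
by apply: eq_bigr => i _; rewrite coef_primitiveS.
Qed.

Lemma deriv_primitive p : (primitive p)^`() = p.
Proof.
apply/polyP => j; rewrite coef_deriv coef_primitiveS -[LHS]mulr_natr.
by rewrite mulfVK // pnatr_eq0.
Qed.

Lemma primitive_linear c p q :
  primitive (c *: p + q) = c *: primitive p + primitive q.
Proof.
apply/polyP => -[|k]; rewrite coefD coefZ ?coef_primitive0 ?mulr0 ?addr0//.
by rewrite !coef_primitiveS coefD coefZ mulrDl mulrA.
Qed.

Lemma primitiveN p : primitive (- p) = - primitive p.
Proof.
apply/polyP => -[|k]; rewrite coefN ?coef_primitive0 ?oppr0//.
by rewrite !coef_primitiveS coefN mulNr.
Qed.

End primitive.

Lemma Rintegral_horner {R : realType} (p : {poly R}) :
  \int[lebesgue_measure]_(t in `[0%R, 1%R]) p.[t] = (primitive p).[1].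
Proof.
rewrite /Rintegral (@continuous_FTC2 _ _ (horner (primitive p))) //=.
- by rewrite horner_coef0 coef_primitive0 subr0.
- exact/continuous_subspaceT/continuous_horner.
- split; first by move=> x _; exact: derivable_horner.
    exact/cvg_at_right_filter/continuous_horner.
  exact/cvg_at_left_filter/continuous_horner.
- by move=> x _; rewrite -derivE deriv_primitive.
Qed.

(** Read through a real-linear form phi (below, the real or the imaginary part),
    the integrand is a polynomial in t with real coefficients, so that only real
    polynomials have to be integrated. *)
Lemma Rintegral_segment {R : realType} (phi : R[i] -> R) (p : {poly R[i]})
    (z : R[i]) :
  phi 0 = 0 -> {morph phi : x y / x + y} ->
  (forall (t : R) x, phi (t%:C * x) = t * phi x) ->
  \int[lebesgue_measure]_(t in `[0%R, 1%R]) phi (p.[t%:C * z] * z) =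
  phi (primitive p).[z].
Proof.
move=> phi0 phiD phiZ.
pose g : {poly R} := \poly_(j < size p) phi (p`_j * z ^+ j.+1).
rewrite (_ : (fun t => _) = (fun t => g.[t])); last first.
  apply/funext => t; rewrite horner_poly horner_coef mulr_suml.
  rewrite (big_morph _ phiD phi0); apply: eq_bigr => i _.
  rewrite [RHS]mulrC -phiZ rmorphXn exprMn exprSr; congr phi.
  by rewrite mulrCA !mulrA.
rewrite Rintegral_horner (@horner_primitive _ (size p)) ?size_poly//.
rewrite (@horner_primitive _ (size p))// (big_morph _ phiD phi0).
apply: eq_bigr => i _; rewrite coef_poly ltn_ord expr1n mulr1.
rewrite mulrC -phiZ fmorphV rmorph_nat; congr phi.
by rewrite mulrCA mulrA.
Qed.

Lemma segment_integral_horner {R : realType} (p : {poly R[i]}) (z : R[i]) :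
  segment_integral (fun w => p.[w]) z = (primitive p).[z].
Proof.
rewrite /segment_integral !(@Rintegral_segment _ _ p z) //.
- by case: (_.[z]).
- by move=> [a b] [c d].
- by move=> t [a b] /=; rewrite mul0r addr0.
- by move=> [a b] [c d].
- by move=> t [a b] /=; rewrite mul0r subr0.
Qed.

Lemma theta_primitive {R : realType} {n} (zs : 'rV[R[i]]_n) i :
  theta zs ord0 i =
  (primitive (\prod_(j < n) ('X - (zs ord0 j)%:P))).[zs ord0 i].
Proof.
rewrite mxE /p_ -segment_integral_horner; congr segment_integral.
apply/funext => w; rewrite horner_prod.
by apply: eq_bigr => j _; rewrite !hornerE.
Qed.

(** * Multiplicities of roots and derivatives *)

Section roots.
Context {K : numFieldType}.
Implicit Types (p q : {poly K}).

(** In characteristic 0, differentiation lowers the multiplicity of a root by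
    exactly one: if q = g (X - c)^(e+1) with g(c) <> 0, then modulo (X -
    c)^(e+1) the derivative of q is (e+1) g (X - c)^e, which is not zero. *)
Lemma dvdp_XsubC_exp_deriv q c m : root q c ->
  (('X - c%:P) ^+ m %| q^`())%R -> (('X - c%:P) ^+ m.+1 %| q)%R.
Proof.
have [->|q0] := eqVneq q 0; first by rewrite dvdp0.
have [[|e] [g]] := multiplicity_XsubC q c; rewrite q0 /= => gc qE.
  by rewrite qE expr0 mulr1 (negbTE gc).
move=> _; rewrite {1}qE derivM deriv_exp derivXsubC mul1r => dv.
have [em|me] := ltnP e m; last first.
  by rewrite qE dvdp_mull// dvdp_exp2l.
have : (('X - c%:P) ^+ e.+1 %| g * (('X - c%:P) ^+ e *+ e.+1))%R.
  rewrite -(dvdp_addr _ (dvdp_mull g^`() (dvdpp (('X - c%:P) ^+ e.+1)))).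
  exact: dvdp_trans (dvdp_exp2l _ em) dv.
rewrite mulrnAr -mulr_natl mulrA exprS dvdp_mul2r; last first.
  by rewrite expf_neq0// polyXsubC_eq0.
rewrite dvdp_XsubCl rootM (negbTE gc) orbF /root -polyC_natr hornerC.
by rewrite pnatr_eq0.
Qed.

Lemma size_gt_count_roots q (s : seq K) : q != 0 ->
  (forall x, (count_mem x s <= mup x q)%N) -> (size s < size q)%N.
Proof.
elim: s q => [|x s IH] q q0 sq; first by rewrite lt0n size_poly_eq0.
have : root q x.
  by rewrite -dvdp_XsubCl XsubC_dvd// (leq_trans _ (sq x))//= eqxx.
move=> /factor_theorem[q1 qE].
have q10 : q1 != 0 by apply: contraNneq q0 => q10; rewrite qE q10 mul0r.
rewrite qE size_Mmonic ?monicXsubC// size_XsubC addn2 /= ltnS IH// => y.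
have := sq y; rewrite qE mupM// ?polyXsubC_eq0//.
by rewrite (@mup_XsubCX _ 1) /= addnC leq_add2r.
Qed.

(** The induction step that turns any binary product rule into the product rule
    for finite products; it serves for formal derivatives and for strict
    derivatives alike. *)
Lemma leibniz_cons {I : eqType} {C : comNzRingType} (i : I) (s : seq I)
    (p d : I -> C) : uniq (i :: s) ->
  \sum_(k <- i :: s) d k * \prod_(j <- i :: s | j != k) p j =
  d i * \prod_(j <- s) p j +
  p i * \sum_(k <- s) d k * \prod_(j <- s | j != k) p j.
Proof.
move=> /= /andP[si us]; rewrite big_cons big_cons eqxx /=; congr (_ * _ + _).
  rewrite big_seq_cond [RHS]big_seq_cond; apply: eq_bigl => j.
  case js : (j \in s) => //=.
  by apply: contraNneq si => <-.
rewrite mulr_sumr; apply: eq_big_seq => k ks.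
rewrite big_cons; case: eqVneq => [ik|_] /=; last by rewrite mulrCA.
by rewrite ik ks in si.
Qed.

Lemma deriv_prod_seq {I : eqType} (s : seq I) (p : I -> {poly K}) : uniq s ->
  (\prod_(i <- s) p i)^`() =
  \sum_(k <- s) (p k)^`() * \prod_(j <- s | j != k) p j.
Proof.
elim: s => [|i s IH] us; first by rewrite !big_nil derivC.
have /andP[_ us'] := us.
by rewrite leibniz_cons// big_cons derivM IH.
Qed.

Context {n : nat}.
Implicit Types (z h : 'I_n -> K).

(** Each index j of A with z_j = c contributes a factor X - c. *)
Lemma dvdp_prod_XsubC_fiber z (A : pred 'I_n) c m :
  (m <= #|[pred j | A j && (z j == c)]|)%N ->
  (('X - c%:P) ^+ m %| \prod_(j | A j) ('X - (z j)%:P))%R.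
Proof.
move=> mA; apply: dvdp_trans (dvdp_exp2l _ mA) _.
rewrite (bigID (fun j => z j == c)) /=.
rewrite (eq_bigr (fun=> 'X - c%:P)) => [|j /andP[_ /eqP->]//].
by rewrite prodr_const dvdp_mulr.
Qed.

Lemma mup_prod_XsubC_fiber z c :
  mup c (\prod_j ('X - (z j)%:P)) = #|[pred j | z j == c]|.
Proof.
rewrite -(big_map z predT (fun x => 'X - x%:P)) mu_prod_XsubC count_map.
by rewrite -sum1_count -sum1_card.
Qed.

(** Up to sign, the derivative in the direction h of z |-> prod_j (X - z_j). For
    h = 1 it is the derivative of that product with respect to X. *)
Definition weighted_deriv z h : {poly K} :=
  \sum_i h i *: \prod_(j | j != i) ('X - (z j)%:P).

Lemma size_weighted_deriv z h : (size (weighted_deriv z h) <= n)%N.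
Proof.
apply: (leq_trans (size_sum _ _ _)); apply/bigmax_leqP => i _.
rewrite (leq_trans (size_scale_leq _ _))//.
rewrite -big_filter size_prod_XsubC size_filter -sum1_count.
by rewrite -[leqRHS]card_ord -sum1_card [leqRHS](bigD1 i).
Qed.

Lemma deriv_prod_XsubC z :
  (\prod_j ('X - (z j)%:P))^`() = weighted_deriv z (fun=> 1).
Proof.
rewrite deriv_prod_seq ?index_enum_uniq//.
by apply: eq_bigr => i _; rewrite derivXsubC mul1r scale1r.
Qed.

Lemma weighted_deriv_linear z h k c :
  weighted_deriv z (fun i => c * h i + k i) =
  c *: weighted_deriv z h + weighted_deriv z k.
Proof.
rewrite /weighted_deriv scaler_sumr -big_split; apply: eq_bigr => i _ /=.
by rewrite scalerDl scalerA.
Qed.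

(** The algebraic core: injectivity of the derivative of theta on the directions
    that are constant on the blocks. If the sum Q = weighted_deriv z h is not
    zero, then its antiderivative vanishes at 0 and, by [dvdp_XsubC_exp_deriv],
    at each value of z with the multiplicity of that value, which is too much
    for its degree. If Q = 0, then h_i P' = h_i P' - Q is divisible by (X -
    z_i)^m, where P is the product of the X - z_j and m its multiplicity at z_i;
    so h_i <> 0 would make z_i a root of P of multiplicity m + 1. *)
Lemma weighted_deriv_inj z h :
  (forall i, z i != 0) ->
  (forall i j, z i = z j -> h i = h j) ->
  (forall i, (primitive (weighted_deriv z h)).[z i] = 0) ->
  forall i, h i = 0.
Proof.
move=> z0 hz qz i.
pose m c := #|[pred j | z j == c]|.
set Q := weighted_deriv z h in qz *; set q := primitive Q in qz *.
have prod_dvd c k : (('X - c%:P) ^+ (m c - (z k == c))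
    %| \prod_(j | j != k) ('X - (z j)%:P))%R.
  apply: dvdp_prod_XsubC_fiber.
  rewrite /m [in X in (X <= _)%N](cardD1 k) inE addKn.
  by apply/eq_leq/eq_card => j; rewrite !inE.
have [Q0|Q0] := eqVneq Q 0; last first.
  have q0 : q != 0.
    by apply: contraNneq Q0 => q0; rewrite -(deriv_primitive Q) -/q q0 deriv0.
  (* The n + 1 roots of q: 0 and the entries of z, which are not 0. *)
  pose s := 0 :: [seq z j | j <- enum 'I_n].
  have : (size s < size q)%N.
    apply: size_gt_count_roots => // x; rewrite mup_geq//= count_map.
    have -> : count (preim z (pred1 x)) (enum 'I_n) = m x.
      by rewrite -sum1_count /m -sum1_card enumT.
    have [<-|x0] := eqVneq 0 x.
      rewrite (_ : m 0 = 0%N) ?addn0.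
        by rewrite dvdp_XsubCl /root horner_coef0 coef_primitive0.
      by apply: eq_card0 => j; rewrite !inE (negbTE (z0 j)).
    rewrite add0n; case mx : (m x) => [|k]; first by rewrite dvd1p.
    have [j /eqP zj] : exists j, z j == x.
      by apply/card_gt0P; rewrite -/(m x) mx.
    apply: dvdp_XsubC_exp_deriv; first by rewrite -zj /root qz.
    rewrite deriv_primitive /Q /weighted_deriv; elim/big_ind: _ => [|u v|l _].
      exact: dvdp0.
      exact: dvdp_add.
    rewrite -mul_polyC dvdp_mull//.
    apply: dvdp_trans (prod_dvd x l); rewrite dvdp_exp2l// mx.
    by case: (z l == x); rewrite ?subn1 ?subn0.
  rewrite /= size_map size_enum_ord => /leq_trans/(_ (size_primitive _)).
  by rewrite ltnS => /leq_trans/(_ (size_weighted_deriv _ _)); rewrite ltnn.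
apply/eqP; apply: contraT => hi.
pose P := \prod_j ('X - (z j)%:P).
have : (('X - (z i)%:P) ^+ (m (z i)).+1 %| P)%R.
  apply: dvdp_XsubC_exp_deriv; first by
    rewrite /P /root (bigD1 i)//= hornerM !hornerE subrr mul0r.
  rewrite -(dvdpZr _ _ hi).
  have -> : h i *: P^`() =
      \sum_k (h i - h k) *: \prod_(j | j != k) ('X - (z j)%:P).
    rewrite deriv_prod_XsubC -[LHS]subr0 -[X in _ - X = _]Q0 scaler_sumr -sumrB.
    by apply: eq_bigr => k _; rewrite scale1r scalerBl.
  elim/big_ind: _ => [|u v|k _]; first exact: dvdp0.
    exact: dvdp_add.
  have [zki|zki] := eqVneq (z k) (z i).
    by rewrite (hz _ _ zki) subrr scale0r dvdp0.
  rewrite -mul_polyC dvdp_mull//.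
  by have := prod_dvd (z i) k; rewrite (negbTE zki) subn0; apply: dvdp_trans.
have P0 : P != 0 by rewrite monic_neq0// monic_prod_XsubC.
by rewrite -mup_geq// mup_prod_XsubC_fiber ltnn.
Qed.

End roots.

(** * Strict derivatives *)

Lemma lipschitz_at_continuous {K : numFieldType} {V W : normedModType K}
    (f : V -> W) (a : V) (N : set V) (C : K) :
  0 < C -> nbhs a N -> (forall x, N x -> `|f a - f x| <= C * `|a - x|) ->
  {for a, continuous f}.
Proof.
move=> C0 aN fC; apply/cvgrPdist_le => e e0; near=> x.
apply: (@le_trans _ _ (C * `|a - x|)); first by apply: fC; near: x.
rewrite mulrC -ler_pdivlMr//.
by near: x; apply: cvgr_dist_le => //; rewrite divr_gt0.
Unshelve. all: by end_near. Qed.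

Section strict_derivative.
Context {K : numFieldType} {V : normedModType K}.
Implicit Types (a : V) (f g L : V -> K).

(** Strict (Peano) differentiability: both points of the difference quotient are
    free to move near a. The bound on L makes f Lipschitz near a, hence
    continuous at a, which the product rule needs. *)
Definition strict_derivative a f L :=
  (exists2 M, 0 <= M & forall h, `|L h| <= M * `|h|) /\
  forall e, 0 < e -> \forall x & y \near a,
    `|f x - f y - L (x - y)| <= e * `|x - y|.

Lemma eq_strict_derivative a f g L L' :
  f =1 g -> L =1 L' -> strict_derivative a f L -> strict_derivative a g L'.
Proof. by move=> /funext-> /funext->. Qed.

Lemma strict_derivative_cst a (c : K) :
  strict_derivative a (fun=> c) (fun=> 0).
Proof.
split; first by exists 0 => // h; rewrite normr0 mul0r.
move=> e e0; apply: filterE => -[x y] /=; rewrite !subrr normr0.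
by rewrite mulr_ge0 // ltW.
Qed.

Lemma strict_derivativeD a f g L L' :
  strict_derivative a f L -> strict_derivative a g L' ->
  strict_derivative a (fun z => f z + g z) (fun h => L h + L' h).
Proof.
move=> [[M M0 LM] fL] [[M' M'0 LM'] gL'].
split.
  exists (M + M') => [|h]; first exact: addr_ge0.
  rewrite mulrDl (le_trans (ler_normD _ _))//.
  exact: lerD.
move=> e e0; have e2 : 0 < e / 2 by rewrite divr_gt0.
apply: filterS2 (fL _ e2) (gL' _ e2) => -[x y] /= fxy gxy.
rewrite (splitr e) mulrDl.
rewrite (_ : _ - _ = (f x - f y - L (x - y)) +
    (g x - g y - L' (x - y))); last by ring.
by rewrite (le_trans (ler_normD _ _))// lerD.
Qed.

Lemma strict_derivative_lipschitz a f L : strict_derivative a f L ->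
  exists2 M, 0 < M & \forall x & y \near a, `|f x - f y| <= M * `|x - y|.
Proof.
move=> [[M M0 LM] fL]; exists (M + 1); first by rewrite ltr_wpDl.
apply: filterS (fL 1 ltr01) => -[x y] /= fxy.
rewrite -(subrK (L (x - y)) (f x - f y)) (le_trans (ler_normD _ _))//.
by rewrite addrC mulrDl lerD// (le_trans (LM _)).
Qed.

Lemma strict_derivative_continuous a f L : strict_derivative a f L ->
  {for a, continuous f}.
Proof.
move=> /strict_derivative_lipschitz[M M0 [/= P [Pa1 Pa2] PM]].
apply: (lipschitz_at_continuous M0 Pa2) => x Px.
by apply: (PM (a, x)); split => //; exact: nbhs_singleton.
Qed.

(** With h = x - y, the error is the sum of
    (f x - f y - L h) g x, f y (g x - g y - L' h), where a remainder that is
    small compared with |h| multiplies a bounded factor, and of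
    L h (g x - g a), (f y - f a) L' h, where a multiple of |h| multiplies a
    factor that tends to 0. *)
Lemma strict_derivativeM a f g L L' :
  strict_derivative a f L -> strict_derivative a g L' ->
  strict_derivative a (fun z => f z * g z) (fun h => L h * g a + f a * L' h).
Proof.
move=> fL gL'; have fa := strict_derivative_continuous fL.
have ga := strict_derivative_continuous gL'.
case: fL gL' => [[M M0 LM] fL] [[M' M'0 LM'] gL'].
split.
  exists (M * `|g a| + `|f a| * M') => [|h].
    by rewrite addr_ge0 // mulr_ge0.
  rewrite (le_trans (ler_normD _ _))// mulrDl !normrM lerD//.
    by rewrite mulrAC ler_wpM2r.
  by rewrite -mulrA ler_wpM2l.
move=> e e0; pose d := e / 2 / 2.
have d0 : 0 < d by rewrite !divr_gt0.
pose A := `|g a| + 1; have A0 : 0 < A by rewrite ltr_wpDl.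
pose B := `|f a| + 1; have B0 : 0 < B by rewrite ltr_wpDl.
have C0 : 0 < M + 1 by rewrite ltr_wpDl.
have D0 : 0 < M' + 1 by rewrite ltr_wpDl.
have gA : \forall x \near a, `|g x| <= A /\ `|g x - g a| <= d / (M + 1).
  near=> x; have gx1 : `|g x - g a| <= 1.
    by rewrite distrC; near: x; exact: cvgr_dist_le.
  split.
    by rewrite -(subrK (g a) (g x)) (le_trans (ler_normD _ _))// addrC lerD2l.
  by rewrite distrC; near: x; apply: cvgr_dist_le => //; rewrite divr_gt0.
have fB : \forall y \near a, `|f y| <= B /\ `|f y - f a| <= d / (M' + 1).
  near=> x; have fx1 : `|f x - f a| <= 1.
    by rewrite distrC; near: x; exact: cvgr_dist_le.
  split.
    by rewrite -(subrK (f a) (f x)) (le_trans (ler_normD _ _))// addrC lerD2l.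
  by rewrite distrC; near: x; apply: cvgr_dist_le => //; rewrite divr_gt0.
have {}fL := fL _ (divr_gt0 d0 A0).
have {}gL' := gL' _ (divr_gt0 d0 B0).
have {}gA : \forall x & y \near a, `|g x| <= A /\ `|g x - g a| <= d / (M + 1).
  exact: cvg_fst gA.
have {}fB : \forall x & y \near a, `|f y| <= B /\ `|f y - f a| <= d / (M' + 1).
  exact: cvg_snd fB.
apply: filterS2 (filterI fL gL') (filterI gA fB).
move=> [x y] /= [fxy gxy] [[gxA gxa] [fyB fya]].
rewrite [X in `|X|](_ : _ = (f x - f y - L (x - y)) * g x
  + L (x - y) * (g x - g a) + (f y * (g x - g y - L' (x - y))
  + (f y - f a) * L' (x - y))); last by ring.
have h0 : 0 <= `|x - y| by [].
have -> : e * `|x - y| = (d * `|x - y| + d * `|x - y|) +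
    (d * `|x - y| + d * `|x - y|) by rewrite /d; field.
rewrite (le_trans (ler_normD _ _))// lerD//.
  rewrite (le_trans (ler_normD _ _))// lerD//.
    rewrite normrM (le_trans (ler_pM _ _ fxy gxA))//.
    by rewrite mulrAC divfK // gt_eqF.
  rewrite normrM (le_trans (ler_pM _ _ (LM _) gxa))//.
  rewrite mulrC mulrA ler_wpM2r // -mulrA ler_piMr ?ltW//.
  by rewrite mulrC ltr_pdivrMr // mul1r ltrDl.
rewrite (le_trans (ler_normD _ _))// lerD//.
  rewrite normrM (le_trans (ler_pM _ _ fyB gxy))//.
  by rewrite mulrC mulrAC divfK // gt_eqF.
rewrite normrM (le_trans (ler_pM _ _ fya (LM' _)))//.
rewrite mulrA ler_wpM2r // -mulrA ler_piMr ?ltW//.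
by rewrite mulrC ltr_pdivrMr // mul1r ltrDl.
Unshelve. all: by end_near. Qed.

Lemma strict_derivative_sum a n (f L : 'I_n -> V -> K) :
  (forall i, strict_derivative a (f i) (L i)) ->
  strict_derivative a (fun z => \sum_i f i z) (fun h => \sum_i L i h).
Proof.
elim: n f L => [|n IH] f L fL.
  by apply: eq_strict_derivative (strict_derivative_cst a 0) => z;
    rewrite big_ord0.
have fL' := IH _ _ (fun i => fL (lift ord0 i)).
by apply: eq_strict_derivative (strict_derivativeD (fL ord0) fL') => z;
  rewrite big_ord_recl.
Qed.

End strict_derivative.

(** * Completeness of the complex plane *)

(** The norms of R[i] and of modules over R[i] take values in R[i]; a bound e >
    0 there is a positive real number. *)
Lemma complex_real_gt0 {R : realType} (e : R[i]) : 0 < e ->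
  0 < complex.Re e /\ e = (complex.Re e)%:C.
Proof.
by case: e => a b; rewrite ltcE /= => /andP[/eqP -> ?]; split.
Qed.

Lemma normc_real {R : realType} (x : R) : `|x%:C| = `|x|%:C.
Proof. by rewrite normc_def /= expr0n addr0 sqrtr_sqr. Qed.

Lemma normc_le_ReIm {R : realType} (z : R[i]) :
  `|z| <= (`|complex.Re z| + `|complex.Im z|)%:C.
Proof.
rewrite {1}(complexE z) (le_trans (ler_normD _ _))// rmorphD /=.
rewrite normrM !normc_real lerD// (_ : `|_| = 1) ?mul1r//.
by rewrite normc_def /= expr0n add0r expr1n sqrtr1.
Qed.

Lemma normc_ge_Im {R : realType} (z : R[i]) : `|complex.Im z|%:C <= `|z|.
Proof.
rewrite normc_def lecR -sqrtr_sqr ler_sqrt ?addr_ge0 ?sqr_ge0//.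
by rewrite lerDr sqr_ge0.
Qed.

(** The real and the imaginary part of a Cauchy filter are Cauchy filters on the
    complete space R. *)
Lemma complex_complete {R : realType} (F : set_system R[i]) :
  ProperFilter F -> cauchy F -> cvg F.
Proof.
move=> FF /cauchy_ballP Fc.
have Fre : cvg (@complex.Re R @ F).
  apply/cauchy_cvgP/cauchy_ballP => e e0; rewrite near_map2.
  have eC : 0 < e%:C by rewrite ltcR.
  apply: filterS (Fc _ eC) => -[x y] /=; rewrite -!ball_normE /= => xy.
  rewrite -ltcR; apply: le_lt_trans xy.
  rewrite -[_ - _](raddfB (@complex.Re R : Rcomplex R -> R)).
  exact: normc_ge_Re.
have Fim : cvg (@complex.Im R @ F).
  apply/cauchy_cvgP/cauchy_ballP => e e0; rewrite near_map2.
  have eC : 0 < e%:C by rewrite ltcR.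
  apply: filterS (Fc _ eC) => -[x y] /=; rewrite -!ball_normE /= => xy.
  rewrite -ltcR; apply: le_lt_trans xy.
  rewrite -[_ - _](raddfB (@complex.Im R : Rcomplex R -> R)).
  exact: normc_ge_Im.
apply/cvg_ex; exists (lim (@complex.Re R @ F) +i* lim (@complex.Im R @ F)).
apply/cvgrPdist_le => e /complex_real_gt0[]; set r := complex.Re e => r0 ->.
have r2 : 0 < r / 2 by rewrite divr_gt0.
have /cvgrPdist_le/(_ _ r2) Fre' := Fre.
have /cvgrPdist_le/(_ _ r2) Fim' := Fim.
apply: filterS2 Fre' Fim' => z zre zim.
rewrite (le_trans (normc_le_ReIm _))// lecR (splitr r).
by case: z zre zim => a b zre zim; rewrite lerD.
Qed.

HB.instance Definition _ (R : realType) :=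
  Uniform_isComplete.Build R[i] (@complex_complete R).

HB.instance Definition _ (R : realType) (m n : nat) :=
  Complete.on 'M[R[i]]_(m, n).

(** * The inverse function theorem *)

Lemma complex_expr2V_small {R : realType} (e : R[i]) : 0 < e ->
  exists N, 2 ^- N < e.
Proof.
move=> /complex_real_gt0[r0 ->].
have [N _ /(_ N)] := near_infty_natSinv_expn_lt (PosNum r0).
move=> /(_ (leqnn _)) /= h; exists N.
rewrite (_ : 2 = 2%:C); last by rewrite rmorph_nat.
by rewrite -rmorphXn -fmorphV ltcR -div1r.
Qed.

Section near_identity.
Context {R : realType} {V : completeNormedModType R[i]}.

(** If phi is a contraction with factor 1/2 on the ball of radius d around x0,
    then x + phi x takes all values within d / 2 of its value at x0. A solution
    of x + phi x = y is a fixed point of x |-> y - phi x, and the iterates from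
    x0 stay in the ball: their successive distances are at most h / 2^k, where h
    is the distance from y to x0 + phi x0, and 2 h < d. *)
Lemma near_identity_solve (phi : V -> V) (x0 y : V) (d : R[i]) :
  (forall u v, `|u - x0| < d -> `|v - x0| < d ->
     `|phi u - phi v| <= 2^-1 * `|u - v|) ->
  `|y - (x0 + phi x0)| < 2^-1 * d ->
  exists2 x, `|x - x0| < d & x + phi x = y.
Proof.
move=> phi_lip; set h := `|_ - _| => hd.
pose u k := iter k (fun x => y - phi x) x0.
have uS k : u k.+1 = y - phi (u k) by [].
have h2d : 2 * h < d.
  by rewrite -ltr_pdivlMl.
have h0 : 0 <= h by exact: normr_ge0.
have d0 : 0 < d by apply: le_lt_trans h2d; rewrite mulr_ge0.
have p0 k : 0 < 2 ^- k :> R[i] by rewrite invr_gt0 exprn_gt0.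
have inball k t : t <= 2 * h * (1 - 2 ^- k) -> t < d.
  move=> /le_lt_trans; apply; apply: le_lt_trans h2d.
  by rewrite ler_piMr ?mulr_ge0// lerBlDr lerDl ltW.
have step k : `|u k - x0| <= 2 * h * (1 - 2 ^- k) /\
    `|u k.+1 - u k| <= h * 2 ^- k.
  elim: k => [|k [IH1 IH2]].
    split; first by rewrite subrr normr0 expr0 invr1 subrr mulr0.
    by rewrite expr0 invr1 mulr1 /u /= /h opprD addrA addrAC.
  have IH1' : `|u k.+1 - x0| <= 2 * h * (1 - 2 ^- k.+1).
    have -> : 2 * h * (1 - 2 ^- k.+1) = 2 * h * (1 - 2 ^- k) + h * 2 ^- k.
      by rewrite exprS; field; rewrite expf_neq0.
    by rewrite [leRHS]addrC (le_trans (ler_distD (u k) _ _))// lerD.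
  split=> //.
  have -> : u k.+2 - u k.+1 = phi (u k) - phi (u k.+1).
    by rewrite !uS opprB addrC addrA subrK.
  rewrite (le_trans (phi_lip _ _ _ _))//.
  - exact: inball IH1.
  - exact: inball IH1'.
  rewrite distrC exprS invfM [leRHS]mulrCA.
  by rewrite ler_wpM2l.
have tail k m : `|u (k + m)%N - u k| <= 2 * h * 2 ^- k.
  suff : `|u (k + m)%N - u k| <= 2 * h * (2 ^- k - 2 ^- (k + m)).
    move/le_trans; apply; rewrite ler_wpM2l ?mulr_ge0//.
    by rewrite lerBlDr lerDl ltW.
  elim: m => [|m IH]; first by rewrite addn0 !subrr normr0 mulr0.
  rewrite addnS.
  have -> : 2 * h * (2 ^- k - 2 ^- (k + m).+1) =
      2 * h * (2 ^- k - 2 ^- (k + m)) + h * 2 ^- (k + m).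
    by rewrite exprS exprD; field; rewrite !expf_neq0.
  rewrite (le_trans (ler_distD (u (k + m)%N) _ _))// addrC lerD//.
  exact: (step _).2.
have ucvg : cvgn u.
  apply/cauchy_cvgP/cauchy_ballP => e e0; rewrite near_map2.
  have [N Ne] : exists N, 2 * h * 2 ^- N < e / 2.
    have q0 : 0 < e / 2 / (2 * h + 1).
      by rewrite !divr_gt0// ltr_wpDl// mulr_ge0.
    have [N Ne] := complex_expr2V_small q0; exists N.
    apply: (@le_lt_trans _ _ ((2 * h + 1) * 2 ^- N)).
      by rewrite ler_wpM2r ?(ltW (p0 _))// lerDl.
    by rewrite mulrC -ltr_pdivlMr// ltr_wpDl// mulr_ge0.
  exists ([set n | (N <= n)%N], [set n | (N <= n)%N]) => /=.
    by split; exists N.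
  move=> [n m] /= [Nn Nm]; rewrite -ball_normE /= (splitr e).
  rewrite (le_lt_trans (ler_distD (u N) _ _))// ltrD//.
    by rewrite -(subnKC Nn) (le_lt_trans (tail _ _)).
  by rewrite distrC -(subnKC Nm) (le_lt_trans (tail _ _)).
have {}ucvg e : 0 < e ->
    exists2 k, `|limn u - u k| < e & `|limn u - u k.+1| < e.
  move=> e0; move/cvgrPdist_lt : ucvg => /(_ _ e0)[N _ Nu].
  by exists N; apply: Nu => /=.
have ld : `|limn u - x0| < d.
  have [k uk _] : exists2 k, `|limn u - u k| < d - 2 * h & True.
    have [|k uk _] := ucvg (d - 2 * h); first by rewrite subr_gt0.
    by exists k.
  rewrite (le_lt_trans (ler_distD (u k) _ _))// -(subrK (2 * h) d) ltr_leD//.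
  by rewrite (le_trans (step k).1)// ler_piMr ?mulr_ge0// lerBlDr lerDl ltW.
exists (limn u) => //.
apply/eqP; rewrite -subr_eq0 -normr_le0; apply/ler_addgt0Pr => e e0.
rewrite add0r.
have [k uk uk1] := ucvg _ (divr_gt0 e0 (ltr0Sn _ 1)).
have -> : limn u + phi (limn u) - y =
    (limn u - u k.+1) + (phi (limn u) - phi (u k)).
  by rewrite uS opprB addrACA [X in _ = _ + X]addrAC subrr add0r.
rewrite (splitr e) (le_trans (ler_normD _ _))// lerD ?ltW//.
rewrite (le_lt_trans (phi_lip _ _ ld _))//; first exact: inball (step k).1.
by rewrite (le_lt_trans _ uk)// ler_piMl// invf_le1// ler1n.
Qed.

End near_identity.

Section row_norm.
Context {K : numFieldType} {n : nat}.

Lemma row_norm_ge (v : 'rV[K]_n) i : `|v ord0 i| <= `|v|.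
Proof.
rewrite [leRHS]/Num.norm /= /mx_norm -[leLHS]nngE num_le.
exact: (le_bigmax _ (fun k : 'I_1 * 'I_n => `|v k.1 k.2|%:nng) (ord0, i)).
Qed.

Lemma row_norm_le (v : 'rV[K]_n) e :
  0 <= e -> (forall i, `|v ord0 i| <= e) -> `|v| <= e.
Proof.
move=> e0 ve; rewrite [leLHS]/Num.norm /=.
have [->//|/mx_norm_neq0[[j i] ->]] := eqVneq (mx_norm v) 0.
by rewrite /= ord1.
Qed.

Lemma strict_derivative_coord (a : 'rV[K]_n) i :
  strict_derivative a (fun z => z ord0 i) (fun h => h ord0 i).
Proof.
split; first by exists 1 => // h; rewrite mul1r row_norm_ge.
move=> e e0; apply: filterE => -[x y] /=.
by rewrite !mxE subrr normr0 mulr_ge0// ltW.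
Qed.

Lemma mulmxr_continuous (B : 'M[K]_n) :
  continuous (fun v : 'rV[K]_n => v *m B).
Proof.
move=> v; pose C := \sum_i \sum_j `|B j i| + 1.
have C0 : 0 < C.
  by rewrite ltr_wpDl// sumr_ge0// => i _; rewrite sumr_ge0.
apply: (lipschitz_at_continuous C0 (@filterT _ _ (nbhs_filter v))) => w _.
apply: row_norm_le => [|i]; first by rewrite mulr_ge0// ltW.
rewrite -mulmxBl mxE (le_trans (ler_norm_sum _ _ _))//.
apply: (@le_trans _ _ (\sum_j `|v - w| * `|B j i|)).
  by apply: ler_sum => j _; rewrite normrM ler_wpM2r// row_norm_ge.
rewrite -mulr_sumr mulrC ler_wpM2r// /C [in leRHS](bigD1 i)//= -addrA lerDl.
by rewrite addr_ge0// sumr_ge0// => k _; rewrite sumr_ge0.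
Qed.

End row_norm.

(** After composition with the inverse of A, the derivative at a becomes the
    identity. Strictness then says that on a small ball the map is the identity
    plus a contraction with factor 1/2, which gives injectivity, continuity and,
    by [near_identity_solve] on smaller balls, openness. *)
Lemma inverse_function {R : realType} n (F : 'rV[R[i]]_n -> 'rV[R[i]]_n)
    (a : 'rV[R[i]]_n) (A : 'M[R[i]]_n) (N : set 'rV[R[i]]_n) :
  A \in unitmx ->
  (forall i, strict_derivative a (fun z => F z ord0 i)
     (fun h => (h *m A) ord0 i)) ->
  nbhs a N ->
  exists U : set 'rV[R[i]]_n, [/\ open U, U a, U `<=` N,
    forall u v, U u -> U v -> F u = F v -> u = v &
    forall u, U u -> {for u, continuous F} /\
      forall M, nbhs u M -> nbhs (F u) (F @` M)].
Proof.
move=> Aunit dF aN.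
pose G z := F z *m invmx A.
have GA z : G z *m A = F z by rewrite mulmxKV.
have dG i : strict_derivative a (fun z => G z ord0 i) (fun h => h ord0 i).
  have -> : (fun z => G z ord0 i) =
      fun z => \sum_j F z ord0 j * invmx A j i.
    by apply/funext => z; rewrite mxE.
  have -> : (fun h : 'rV[R[i]]_n => h ord0 i) = fun h =>
      \sum_j ((h *m A) ord0 j * invmx A j i + F a ord0 j * 0).
    apply/funext => h; rewrite -{1}(mulmxK Aunit h) mxE.
    by apply: eq_bigr => j _; rewrite mulr0 addr0.
  apply: strict_derivative_sum => j.
  exact: strict_derivativeM (dF j) (strict_derivative_cst _ _).
have half0 : 0 < 2^-1 :> R[i] by rewrite invr_gt0.
have [[P1 P2] /= [aP1 aP2] PG] := @filter_forall _ _ _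
  (filter_prod (nbhs a) (nbhs a)) _ (fun i => (dG i).2 _ half0).
have nP : nbhs a (P1 `&` P2 `&` N) by apply: filterI => //; exact: filterI.
have [r /= r0 rP] := (nbhs_ballP _ _).1 nP.
have Glip x y : ball a r x -> ball a r y ->
    `|G x - G y - (x - y)| <= 2^-1 * `|x - y|.
  move=> /rP[[P1x _] _] /rP[[_ P2y] _].
  apply: row_norm_le => [|i]; first by rewrite mulr_ge0// invr_ge0.
  by have := PG (x, y) (conj P1x P2y) i; rewrite !mxE.
have Gexp x y : ball a r x -> ball a r y -> `|x - y| <= 2 * `|G x - G y|.
  move=> ax ay; have := Glip _ _ ax ay.
  rewrite distrC => /(le_trans (lerB_dist _ _)).
  rewrite lerBlDr -lerBlDl -{1}[`|x - y|]mul1r -mulrBl.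
  rewrite (_ : 1 - 2^-1 = 2^-1 :> R[i]); last by field.
  by rewrite ler_pdivrMl.
exists (ball a r); split=> //.
- exact: ball_open.
- exact: ballxx.
- by move=> z /rP[].
- move=> u v au av Fuv; apply/eqP; rewrite -subr_eq0 -normr_le0.
  by rewrite (le_trans (Gexp _ _ au av))// /G Fuv subrr normr0 mulr0.
move=> u au.
have nu : nbhs u (ball a r).
  by apply: open_nbhs_nbhs; split=> //; exact: ball_open.
split.
  rewrite (_ : F = (fun v => v *m A) \o G); last first.
    by apply/funext => z /=; rewrite GA.
  apply: continuous_comp; last exact: mulmxr_continuous.
  apply: (@lipschitz_at_continuous _ _ _ _ _ _ 2 _ nu) => // x ax.
  rewrite -(subrK (u - x) (G u - G x)) (le_trans (ler_normD _ _))//.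
  rewrite mulrDl mul1r lerD// (le_trans (Glip _ _ au ax))//.
  by rewrite ler_piMl// invf_le1// ler1n.
move=> M uM.
have Mball : nbhs u (M `&` ball a r) by exact: filterI.
have [d /= d0 dM] := (nbhs_ballP _ _).1 Mball.
have : \forall w \near F u, `|w *m invmx A - G u| < 2^-1 * d.
  have d2 : 0 < 2^-1 * d by rewrite mulr_gt0// invr_gt0.
  have /cvgrPdist_lt/(_ _ d2) := @mulmxr_continuous _ _ (invmx A) (F u).
  by apply: filterS => w; rewrite distrC.
apply: filterS => w wu.
have [||x xu xw] :=
  @near_identity_solve _ _ (fun z => G z - z) u (w *m invmx A) d.
- move=> x y xu yu.
  have [_ ax] : (M `&` ball a r) x by apply: dM; rewrite -ball_normE /= distrC.
  have [_ ay] : (M `&` ball a r) y by apply: dM; rewrite -ball_normE /= distrC.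
  by rewrite opprD addrACA -opprD Glip.
- by rewrite [u + _]addrC subrK.
have [Mx _] : (M `&` ball a r) x by apply: dM; rewrite -ball_normE /= distrC.
exists x => //; rewrite -GA.
by move: xw; rewrite [x + _]addrC subrK => ->; rewrite mulmxKV.
Qed.

(** * Strict derivatives of families of polynomials *)

Section polynomial_families.
Context {K : numFieldType} {V : normedModType K}.
Implicit Types (a : V) (P Q dP dQ : V -> {poly K}).

(** Strict differentiability of a family of polynomials, coefficient by
    coefficient. The Leibniz rule holds for it because a coefficient of a
    product is a finite sum of products of coefficients. *)
Definition strict_poly_derivative a P dP :=
  forall k, strict_derivative a (fun z => (P z)`_k) (fun h => (dP h)`_k).

Lemma strict_derivativeX a (f L : V -> K) k : strict_derivative a f L ->
  strict_derivative a (fun z => f z ^+ k.+1)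
    (fun h => k.+1%:R * f a ^+ k * L h).
Proof.
move=> fL; elim: k => [|k IH].
  apply: eq_strict_derivative fL => // h; by rewrite expr0 !mul1r.
apply: eq_strict_derivative (strict_derivativeM fL IH) => [z|h].
  by rewrite -exprS.
by rewrite [k.+2%:R]mulrSr exprS; ring.
Qed.

Lemma strict_poly_derivativeM a P Q dP dQ :
  strict_poly_derivative a P dP -> strict_poly_derivative a Q dQ ->
  strict_poly_derivative a (fun z => P z * Q z)
    (fun h => dP h * Q a + P a * dQ h).
Proof.
move=> PdP QdQ k.
pose f (j : 'I_k.+1) z := (P z)`_j * (Q z)`_(k - j).
apply: (@eq_strict_derivative _ _ _ (fun z => \sum_j f j z)); last first.
- apply: strict_derivative_sum => j; exact: strict_derivativeM.
- by move=> h /=; rewrite coefD !coefM -big_split.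
- by move=> z; rewrite coefM.
Qed.

Lemma strict_poly_derivative_prod (I : eqType) (s : seq I) a
    (P dP : I -> V -> {poly K}) : uniq s ->
  (forall i, strict_poly_derivative a (P i) (dP i)) ->
  strict_poly_derivative a (fun z => \prod_(i <- s) P i z)
    (fun h => \sum_(i <- s) dP i h * \prod_(j <- s | j != i) P j a).
Proof.
move=> + PdP; elim: s => [|i s IH] us k.
  apply: eq_strict_derivative (strict_derivative_cst a ((1 : {poly K})`_k)).
    by move=> z; rewrite big_nil.
  by move=> h; rewrite big_nil coef0.
have /andP[_ us'] := us.
apply: eq_strict_derivative (strict_poly_derivativeM (PdP i) (IH us') k).
  by move=> z; rewrite big_cons.
move=> h.
by rewrite (@leibniz_cons _ _ _ _ (fun j => P j a) (fun j => dP j h) us).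
Qed.

Lemma strict_poly_derivative_XsubC a (f L : V -> K) :
  strict_derivative a f L ->
  strict_poly_derivative a (fun z => 'X - (f z)%:P) (fun h => - (L h)%:P).
Proof.
move=> fL k; case: k => [|k].
  apply: eq_strict_derivative
    (strict_derivativeM (strict_derivative_cst a (-1)) fL) => [z|h].
    by rewrite coefB coefX coefC sub0r mulN1r.
  by rewrite coefN coefC /= mul0r add0r mulN1r.
apply: eq_strict_derivative
  (strict_derivative_cst a (('X : {poly K})`_k.+1)) => [z|h].
  by rewrite coefB coefC subr0.
by rewrite coefN coefC oppr0.
Qed.

Lemma strict_poly_derivative_prod_XsubC n a (f L : 'I_n -> V -> K) :
  (forall l, strict_derivative a (f l) (L l)) ->
  strict_poly_derivative a (fun z => \prod_l ('X - (f l z)%:P))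
    (fun h => - weighted_deriv (f ^~ a) (L ^~ h)).
Proof.
move=> fL k; have := @strict_poly_derivative_prod _ _ a _ _
  (index_enum_uniq 'I_n) (fun l => strict_poly_derivative_XsubC (fL l)) k.
apply: eq_strict_derivative => // h; congr (polyseq _)`_k.
rewrite /weighted_deriv -sumrN; apply: eq_bigr => l _.
by rewrite -mul_polyC mulNr.
Qed.

(** The chain rule for evaluating the antiderivative of P z at a moving point f
    z: the moving point contributes (P a)(f a), the integrand at the end point.
    The uniform bound N on the degrees makes the evaluation a fixed finite sum.
    *)
Lemma strict_derivative_primitive a N P dP (f L : V -> K) :
  (forall z, (size (P z) <= N)%N) -> (forall h, (size (dP h) <= N)%N) ->
  strict_poly_derivative a P dP -> strict_derivative a f L ->
  strict_derivative a (fun z => (primitive (P z)).[f z])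
    (fun h => (primitive (dP h)).[f a] + (P a).[f a] * L h).
Proof.
move=> PN dPN PdP fL.
pose g (j : 'I_N) z := (P z)`_j * (j.+1%:R^-1 * f z ^+ j.+1).
apply: (@eq_strict_derivative _ _ _ (fun z => \sum_j g j z)); last first.
- apply: strict_derivative_sum => j; apply: strict_derivativeM => //.
  apply: strict_derivativeM; first exact: strict_derivative_cst.
  exact: (strict_derivativeX j fL).
- move=> h /=; rewrite (horner_primitive _ (dPN h)) (horner_coef_wide _ (PN a)).
  rewrite mulr_suml -big_split; apply: eq_bigr => j _ /=.
  by rewrite mul0r add0r; field; rewrite nat1r pnatr_eq0.
- move=> z; rewrite (horner_primitive _ (PN z)).
  by apply: eq_bigr => j _; rewrite /g mulrA.
Qed.

End polynomial_families.

(** * An extension of theta that keeps track of the stratum *)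

Lemma near_continuous_neq {K : numFieldType} {T : topologicalType}
    (f g : T -> K) (x : T) :
  {for x, continuous f} -> {for x, continuous g} -> f x != g x ->
  \forall y \near x, f y != g y.
Proof.
move=> fx gx; rewrite -subr_eq0 => fgx.
have fg : \forall y \near x, f y - g y != 0.
  exact: cvgr_neq0 _ (cvgB fx gx) fgx.
by near=> y; rewrite -subr_eq0; near: y.
Unshelve. all: by end_near. Qed.

Lemma near_coord_neq {K : numFieldType} {n} (z : 'rV[K]_n) i j :
  z ord0 i != z ord0 j -> \forall w \near z, (w : 'rV[K]_n) ord0 i != w ord0 j.
Proof.
by apply: (near_continuous_neq
  (f := fun w : 'rV[K]_n => w ord0 i) (g := fun w : 'rV[K]_n => w ord0 j));
  exact: coord_continuous.
Qed.

(** Two distinct affine functions of t differ at all small nonzero t, whether or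
    not they agree at t = 0. *)
Lemma near_line_neq {K : numFieldType} (x y u v : K) :
  x != y \/ u != v -> \forall t \near 0^', x + t * u != y + t * v.
Proof.
move=> xyuv.
have E t : (x + t * u != y + t * v) = (x - y + t * (u - v) != 0).
  by rewrite -subr_eq0; congr (_ != _); ring.
have [xy|xy] := eqVneq x y.
  case: xyuv => [|uv]; first by rewrite xy eqxx.
  near=> t; rewrite E xy subrr add0r mulf_neq0 ?subr_eq0//.
  by near: t; exact: nbhs_dnbhs_neq.
have c (a b : K) : {for 0, continuous (fun t : K => a + t * b)}.
  by apply: (@continuousD _ _ _ (fun=> a) (fun t : K => t * b));
    [exact: cst_continuous | exact: mulrr_continuous].
apply: nbhs_dnbhs; apply: (near_continuous_neq (c x u) (c y v)).
by rewrite !mul0r !addr0.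
Unshelve. all: by end_near. Qed.

Section equal_on_fibers.
Context {R : realType} {n : nat} (r : 'I_n -> 'I_n).
Hypothesis rr : forall i, r (r i) = r i.
Local Notation V := 'rV[R[i]]_n.
Implicit Types (z a h : V).

Definition fiber_constant : set V :=
  [set z | forall i, z ord0 (r i) = z ord0 i].

(** The map theta composed with the projection z |-> (z_(r i))_i onto the
    [fiber_constant] points, plus the component of z that this projection kills.
    *)
Definition theta_ext z : V := \row_i
  ((primitive (\prod_l ('X - (z ord0 (r l))%:P))).[z ord0 (r i)] +
   (z ord0 i - z ord0 (r i))).

Lemma theta_extE z : fiber_constant z -> theta_ext z = theta z.
Proof.
move=> zD; apply/rowP => i; rewrite theta_primitive mxE !zD subrr addr0.
by congr (primitive _).[_]; apply: eq_bigr => j _; rewrite zD.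
Qed.

(** The added term z_i - z_(r i) is recovered from the value as the difference
    of its coordinates i and r i. *)
Lemma fiber_constant_theta_ext z :
  fiber_constant (theta_ext z) <-> fiber_constant z.
Proof.
have diff i : theta_ext z ord0 i - theta_ext z ord0 (r i) =
    z ord0 i - z ord0 (r i).
  by rewrite !mxE rr subrr addr0 addrAC subrr add0r.
split=> zD i; apply/eqP; rewrite eq_sym -subr_eq0.
  by rewrite -diff zD subrr.
by rewrite diff zD subrr.
Qed.

Definition dtheta_ext a h : V := \row_i
  (- (primitive (weighted_deriv (a ord0) (fun l => h ord0 (r l)))).[a ord0 i] +
   (h ord0 i - h ord0 (r i))).

Lemma dtheta_ext_is_linear a : linear (dtheta_ext a).
Proof.
move=> c u v; apply/rowP => i; rewrite !mxE.
have -> : weighted_deriv (a ord0) (fun l => (c *: u + v) ord0 (r l)) =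
    weighted_deriv (a ord0) (fun l => c * u ord0 (r l) + v ord0 (r l)).
  by apply: eq_bigr => l _; rewrite !mxE.
rewrite weighted_deriv_linear primitive_linear hornerD hornerZ; ring.
Qed.

(** If the derivative kills h, its coordinates r i show that the antiderivative
    vanishes at all entries of a; the coordinates i then show that h is constant
    on the fibers of r, and [weighted_deriv_inj] applies. *)
Lemma dtheta_ext_inj a h : (forall i, a ord0 i != 0) ->
  fiber_constant a -> (forall i j, a ord0 i = a ord0 j -> r i = r j) ->
  dtheta_ext a h = 0 -> h = 0.
Proof.
move=> a0 aD ar h0.
pose q := primitive (weighted_deriv (a ord0) (fun l => h ord0 (r l))).
have dh0 i : - q.[a ord0 i] + (h ord0 i - h ord0 (r i)) = 0.
  by move/rowP/(_ i): h0; rewrite !mxE.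
have q0 i : q.[a ord0 i] = 0.
  have /eqP := dh0 (r i); rewrite rr subrr addr0 aD oppr_eq0.
  by move/eqP.
have hr i : h ord0 i = h ord0 (r i).
  by have /eqP := dh0 i; rewrite q0 oppr0 add0r subr_eq0 => /eqP.
apply/rowP => i; rewrite mxE hr.
by apply: (weighted_deriv_inj a0 _ q0) => j k /ar ->.
Qed.

Lemma strict_derivative_theta_ext a i : fiber_constant a ->
  strict_derivative a (fun z => theta_ext z ord0 i)
    (fun h => dtheta_ext a h ord0 i).
Proof.
move=> aD.
pose P (z : V) := \prod_l ('X - (z ord0 (r l))%:P).
pose dP (h : V) := - weighted_deriv (a ord0) (fun l => h ord0 (r l)).
have dPE : strict_poly_derivative a P dP.
  have := strict_poly_derivative_prod_XsubC
    (fun l => strict_derivative_coord a (r l)).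
  rewrite (_ : (fun l => a ord0 (r l)) = a ord0) //.
  by apply/funext => l; rewrite aD.
have sP z : (size (P z) <= n.+1)%N.
  by rewrite size_prod_XsubC -sum1_size sum1_card card_ord.
have sdP h : (size (dP h) <= n.+1)%N.
  by rewrite size_polyN (leq_trans (size_weighted_deriv _ _)).
have dz := strict_derivative_coord a.
have := strict_derivativeD (strict_derivative_primitive sP sdP dPE (dz (r i)))
  (strict_derivativeD (dz i)
    (strict_derivativeM (strict_derivative_cst a (-1)) (dz (r i)))).
apply: eq_strict_derivative => [z|h]; rewrite mxE; first by rewrite mulN1r.
rewrite /dP primitiveN hornerN aD.
have -> : (P a).[a ord0 i] = 0.
  by rewrite /P (bigD1 i)//= hornerM !hornerE aD subrr mul0r.
by rewrite !mul0r addr0 add0r mulN1r.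
Qed.

Definition fibers_exactly : set V :=
  [set z | forall i j, z ord0 i = z ord0 j <-> r i = r j].

Lemma fibers_exactly_constant : fibers_exactly `<=` fiber_constant.
Proof. by move=> z zr i; apply/zr. Qed.

Lemma near_fibers_distinct z : fibers_exactly z ->
  nbhs z [set w : V | forall i j, r i != r j -> w ord0 i != w ord0 j].
Proof.
move=> zr.
apply: (@filter_forall _ _ _ (nbhs z) (nbhs_filter z)) => i.
apply: (@filter_forall _ _ _ (nbhs z) (nbhs_filter z)) => j.
have [rij|rij] := eqVneq (r i) (r j).
  by apply: (@filterS _ (nbhs z) (nbhs_filter z) setT) => //; exact: filterT.
have zij : z ord0 i != z ord0 j.
  by apply: contra rij => /eqP/zr->.
by apply: (@filterS _ (nbhs z) (nbhs_filter z) _ _ _ (near_coord_neq zij)).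
Qed.

(** An equality of coordinates passes to the limit. Conversely, a point z that
    is constant on the fibers of r is the limit, as t tends to 0, of the points
    z + t (r i)_i, whose entries are distinct on distinct fibers for all small
    nonzero t. *)
Lemma closure_fibers_exactly : closure fibers_exactly = fiber_constant.
Proof.
apply/seteqP; split=> [z cz i|z zD B zB].
  apply/eqP; apply: contraT => zi.
  have [w [/fibers_exactly_constant wD /=]] := cz _ (near_coord_neq zi).
  by rewrite wD eqxx.
(* A direction whose entries are equal exactly on the fibers of r, because R has
   characteristic 0. *)
pose v : V := \row_i (r i)%:R.
have tv : \forall t \near 0^', fibers_exactly (z + t *: v).
  suff : \forall t \near 0^', forall i j, r i != r j ->
      z ord0 i + t * (r i)%:R != z ord0 j + t * (r j)%:R.
    apply: filterS => t tneq i j; rewrite !mxE; split.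
      by move=> /eqP; apply: contraTeq; exact: tneq.
    by move=> rij; rewrite -[z ord0 i]zD -[z ord0 j]zD rij.
  apply: filter_forall => i; apply: filter_forall => j.
  have [rij|rij] := eqVneq (r i) (r j); first by apply: nearW.
  apply: filterS (near_line_neq (or_intror _)) => //.
    by move=> t + _; apply.
  by rewrite eqr_nat.
have zt : \forall t \near 0^', B (z + t *: v).
  apply: nbhs_dnbhs.
  have c : {for 0, continuous (fun t : R[i] => z + t *: v)}.
    apply: (@lipschitz_at_continuous _ _ _ _ _ _ (`|v| + 1) _ filterT).
      by rewrite ltr_wpDl.
    move=> t _; rewrite scale0r addr0 opprD addrA subrr !sub0r !normrN normrZ.
    by rewrite mulrC ler_wpM2r// lerDl.
  by apply: c; rewrite scale0r addr0.
have [t [ft Bt]] :=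
  @filter_ex _ 0^' (Proper_dnbhs_numFieldType _) _ (filterI tv zt).
by exists (z + t *: v).
Qed.

(** The ball of the inverse function theorem is taken inside the open set where
    entries on distinct fibers are distinct; there, a point is in the stratum as
    soon as it is constant on the fibers, and this can be read off its image. *)
Lemma theta_ext_local_inverse z :
  fibers_exactly z -> (forall i, z ord0 i != 0) ->
  exists U : set V, [/\ open U, U z,
    forall u, U u -> fiber_constant (theta_ext u) -> fibers_exactly u,
    forall u v, U u -> U v -> theta_ext u = theta_ext v -> u = v &
    forall u, U u -> {for u, continuous theta_ext} /\
      forall M, nbhs u M -> nbhs (theta_ext u) (theta_ext @` M)].
Proof.
move=> zr z0.
have zD := fibers_exactly_constant zr.
pose L : {linear V -> V} := HB.pack (dtheta_ext z)
  (GRing.isLinear.Build _ _ _ _ (dtheta_ext z) (dtheta_ext_is_linear z)).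
have Lunit : lin1_mx L \in unitmx.
  rewrite -row_free_unit; apply: inj_row_free => h; rewrite mul_rV_lin1.
  by apply: dtheta_ext_inj => // i j /zr.
have dL i : strict_derivative z (fun w => theta_ext w ord0 i)
    (fun h => (h *m lin1_mx L) ord0 i).
  apply: eq_strict_derivative (strict_derivative_theta_ext i zD) => // h.
  by rewrite mul_rV_lin1.
have [U [Uop Uz UN Uinj Uloc]] :=
  inverse_function Lunit dL (near_fibers_distinct zr).
exists U; split=> // u Uu /fiber_constant_theta_ext uD i j; split.
  by move=> /eqP; apply: contraTeq; exact: UN.
by move=> rij; rewrite -[u ord0 i]uD -[u ord0 j]uD rij.
Qed.

End equal_on_fibers.

(** * Local homeomorphisms between subspaces *)

Lemma set_val_continuous {T : topologicalType} (A : set T) :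
  continuous (set_val : A -> T).
Proof. exact: initial_continuous. Qed.

Lemma continuous_to_set_type {S T : topologicalType} (A : set T) (f : S -> A) :
  continuous (set_val \o f) -> continuous f.
Proof. exact: (continuous_comp_initial (w := set_val)). Qed.

(** A map F that is injective, continuous and open on U restricts to a local
    homeomorphism f from X to Y as soon as, on U, only the points of X are sent
    into Y: this is what makes the image of U in Y a trace of the open set F(U),
    and so open in Y. *)
Lemma local_homeomorphism_at_restriction {V W : topologicalType} (F : V -> W)
    (X : set V) (Y : set W) (f : X -> Y) (U : set V) (x : X) :
  (forall u, set_val (f u) = F (set_val u)) ->
  open U -> U (set_val x) ->
  (forall u v, U u -> U v -> F u = F v -> u = v) ->
  (forall u, U u -> {for u, continuous F}) ->
  (forall u N, U u -> nbhs u N -> nbhs (F u) (F @` N)) ->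
  (forall u, U u -> Y (F u) -> X u) ->
  local_homeomorphism_at f x.
Proof.
move=> fF Uop Ux Finj Fcont Fopen FXY.
pose U' : set X := set_val @^-1` U.
have fU'E : f @` U' = set_val @^-1` (F @` U).
  apply/seteqP; split=> [_ [u Uu <-]|y [u Uu Fuy]] /=.
    by exists (set_val u); rewrite ?fF.
  have Xu : X u by apply: FXY => //; rewrite Fuy; exact: set_valP.
  exists (SigSub (mem_set Xu)); first exact: Uu.
  by apply: val_inj; rewrite -[LHS]/(set_val _) fF -[RHS]/(set_val y) -Fuy.
have FUop : open (F @` U).
  rewrite openE => _ [u Uu <-]; apply: Fopen => //.
  exact: open_nbhs_nbhs.
exists U'; split=> //.
- by apply: open_comp Uop => z _; exact: set_val_continuous.
- by rewrite fU'E; apply: open_comp FUop => z _; exact: set_val_continuous.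
pose fU (u : U') : f @` U' :=
  SigSub (mem_set (ex_intro2 _ _ (set_val u) (set_valP u) erefl)).
exists fU => //; split.
  apply: continuous_to_set_type; apply: continuous_to_set_type => u.
  have -> : set_val \o (set_val \o fU) = (F \o set_val) \o set_val.
    by apply/funext => v /=; rewrite -fF.
  apply: continuous_comp; first exact: set_val_continuous.
  apply: continuous_comp; first exact: set_val_continuous.
  by apply: Fcont; exact: (set_valP u).
have gP (y : f @` U') : {u : X | U' u & f u = set_val y}.
  exact/cid2/(set_valP y).
pose g y : U' := SigSub (mem_set (s2valP (gP y))).
have fg y : f (set_val (g y)) = set_val y by exact: (s2valP' (gP y)).
exists g; split.
- apply: continuous_to_set_type; apply: continuous_to_set_type => y N /= Ngy.
  have Fg z : F (set_val (set_val (g z))) = set_val (set_val z).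
    by rewrite -fF fg.
  have Ug z : U (set_val (set_val (g z))) by exact: (set_valP (g z)).
  have FNU : nbhs (set_val (set_val y)) (F @` (N `&` U)).
    rewrite -Fg; apply: Fopen => //.
    by apply: filterI => //; exact: open_nbhs_nbhs.
  have cval : continuous ((set_val : Y -> W) \o (set_val : f @` U' -> Y)).
    by move=> z; apply: continuous_comp; exact: set_val_continuous.
  have sub (z : f @` U') : (F @` (N `&` U)) (set_val (set_val z)) ->
      N (set_val (set_val (g z))).
    case=> v NUv Fvz. case: NUv => Nv Uv.
    by have -> : set_val (set_val (g z)) = v by apply: Finj => //; rewrite Fg.
  exact: (@filterS _ (nbhs y) (nbhs_filter y) _ _ sub (cval y _ FNU)).
- move=> u; apply: val_inj; apply: val_inj; apply: Finj.
  + exact: (set_valP (g (fU u))).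
  + exact: (set_valP u).
  by have := congr1 set_val (fg (fU u)); rewrite /= !fF.
- by move=> y; apply: val_inj; rewrite -[RHS]fg.
Qed.

(** * The theorem on strata *)

Lemma partition_representative {n} (lambda : {set {set 'I_n}}) :
  finset.partition lambda (finset.setTfor 'I_n) ->
  exists2 r : 'I_n -> 'I_n, forall i, r (r i) = r i &
    forall i j, r i = r j <-> exists2 B, B \in lambda & (i \in B) && (j \in B).
Proof.
move=> /and3P[/eqP cov triv _].
have icov i : i \in finset.cover lambda by rewrite cov finset.in_setT.
pose r i := odflt i [pick j in finset.pblock lambda i].
have rP i : r i \in finset.pblock lambda i.
  rewrite /r; case: pickP => //= /(_ i).
  by rewrite finset.mem_pblock icov.
have rE i j : finset.pblock lambda i = finset.pblock lambda j -> r i = r j.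
  rewrite /r => ->; case: pickP => //= /(_ j).
  by rewrite finset.mem_pblock icov.
have blockr i : finset.pblock lambda (r i) = finset.pblock lambda i.
  exact: finset.def_pblock triv (finset.pblock_mem (icov i)) (rP i).
exists r => [i|i j]; first exact: rE.
split=> [rij|[B Bl /andP[iB jB]]].
  exists (finset.pblock lambda i); first exact: finset.pblock_mem.
  rewrite finset.mem_pblock icov /= -blockr rij blockr.
  by rewrite finset.mem_pblock icov.
apply: rE.
by rewrite (finset.def_pblock triv Bl iB) (finset.def_pblock triv Bl jB).
Qed.

Unset Implicit Arguments.
Set Strict Implicit.

Theorem theoremC (R : realType) (n : nat) (n_gt0 : (0 < n)%N)
    (lambda : {set {set 'I_n}})
    (lambda_partition : finset.partition lambda (finset.setTfor 'I_n)) :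
  exists theta_lambda :
      stratum R lambda -> closure (stratum R lambda),
    (forall zs : stratum R lambda,
       set_val (theta_lambda zs) = theta (set_val zs)) /\
    (forall zs : stratum R lambda,
       (forall i : 'I_n, set_val zs ord0 i != 0) ->
       local_homeomorphism_at theta_lambda zs).
Proof.
have [r rr rlambda] := partition_representative lambda_partition.
have strE : stratum R lambda = fibers_exactly r.
  apply/seteqP; split=> z zs i j; have [h1 h2] := zs i j;
    have [k1 k2] := rlambda i j.
    by split=> [/h1/k2|/k1/h2].
  by split=> [/h1/k1|/k2/h2].
have clE : closure (stratum R lambda) = fiber_constant r.
  by rewrite strE closure_fibers_exactly.
have strD (zs : stratum R lambda) : fiber_constant r (set_val zs).
  by apply: fibers_exactly_constant => //; rewrite -strE; exact: set_valP.
have thetaD (zs : stratum R lambda) :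
    closure (stratum R lambda) (theta (set_val zs)).
  by rewrite clE -(theta_extE (strD zs)); apply/fiber_constant_theta_ext.
exists (fun zs => SigSub (mem_set (thetaD zs))); split=> [//|zs zs0].
have zsr : fibers_exactly r (set_val zs) by rewrite -strE; exact: set_valP.
have [U [Uop Uz Ustr Uinj Uloc]] := theta_ext_local_inverse rr zsr zs0.
apply: (@local_homeomorphism_at_restriction _ _ (theta_ext r) _ _ _ U) => //.
- by move=> u; rewrite theta_extE.
- by move=> u Uu; exact: (Uloc u Uu).1.
- by move=> u N Uu; exact: (Uloc u Uu).2.
- by move=> u Uu; rewrite clE strE; exact: Ustr.
Qed.
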